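(* Let $X$ and $Y$ be locally convex real topological vector spaces in duality via $\langle\cdot,\cdot\rangle : X\times Y\to\mathbb{R}$, with topologies compatible with the duality product. Let $M\subset X\times Y$ be a BB-graph, let $\Lambda$ be a compact Hausdorff space, and let $\lambda\in\Lambda\mapsto\phi_\lambda\in\Gamma_0(X)$ be a convex lagrangian cover of $M$, with $\phi_\lambda^*$ real-valued for every $\lambda\in\Lambda$, such that: (a) for any $x\in X$ and any $y\in Y$ the functions $\Lambda\ni\lambda\mapsto\phi_\lambda(x)\in\mathbb{R}$ and $\Lambda\ni\lambda\mapsto\phi_\lambda^*(y)\in\mathbb{R}$ are continuous; (b) the cover is Fan bi-implicitly convex. Then the function $b:X\times Y\to\mathbb{R}$ defined by $$b(x,y)=\inf\{\phi_\lambda(x)+\phi_\lambda^*(y)\mid\lambda\in\Lambda\}$$ is a bipotential, and $M=M(b)$, where $M(b)=\{(x,y)\in X\times Y\mid b(x,y)=\langle x,y\rangle\}$.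
   Context: Duality: $\langle\cdot,\cdot\rangle:X\times Y\to\mathbb{R}$ is bilinear, and the topologies are compatible with it: the continuous linear functionals on $X$ are exactly the maps $x\mapsto\langle x,y\rangle$ with $y\in Y$, and the continuous linear functionals on $Y$ are exactly the maps $y\mapsto\langle x,y\rangle$ with $x\in X$. Notation: $\bar{\mathbb{R}}=\mathbb{R}\cup\{+\infty\}$. $\Gamma(X)$ is the set of convex lower semicontinuous functions $\phi:X\to\bar{\mathbb{R}}$. $\Gamma_0(X)$ is the set of convex lower semicontinuous functions $\phi:X\to\mathbb{R}$. The Fenchel conjugate of $\phi$ is $\phi^*(y)=\sup\{\langle x,y\rangle-\phi(x)\mid x\in X\}$ for $y\in Y$. The domain $\mathrm{dom}\,\phi$ is the set of points where $\phi\neq+\infty$. For $\phi:X\to\bar{\mathbb{R}}$ and $x\in\mathrm{dom}\,\phi$, the subdifferential is $\partial\phi(x)=\{u\in Y\mid\forall z\in X,\ \langle z-x,u\rangle\le\phi(z)-\phi(x)\}$. For $\psi:Y\to\bar{\mathbb{R}}$ and $y\in\mathrm{dom}\,\psi$, $\partial\psi(y)=\{v\in X\mid\forall w\in Y,\ \langle v,w-y\rangle\le\psi(w)-\psi(y)\}$. For $\phi\in\Gamma(X)$, $M(\phi)=\{(x,y)\in X\times Y\mid\phi(x)+\phi^*(y)=\langle x,y\rangle\}$. BB-graph: for $M\subset X\times Y$ put $m(x)=\{y\in Y\mid(x,y)\in M\}$ and $m^*(y)=\{x\in X\mid(x,y)\in M\}$. A non-empty set $M\subset X\times Y$ is a BB-graph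 (bi-convex, bi-closed) if for every $x$ with $m(x)\neq\emptyset$ the set $m(x)$ is convex and closed, and for every $y$ with $m^*(y)\neq\emptyset$ the set $m^*(y)$ is convex and closed. Bipotential: a function $b:X\times Y\to\bar{\mathbb{R}}$ such that (1) $b$ is convex and lower semicontinuous in each argument separately; (2) $b(x,y)\ge\langle x,y\rangle$ for all $x\in X$, $y\in Y$; (3) for all $(x,y)\in X\times Y$: $y\in\partial b(\cdot,y)(x)\iff x\in\partial b(x,\cdot)(y)\iff b(x,y)=\langle x,y\rangle$. Convex lagrangian cover: a convex lagrangian cover of a non-empty set $M\subset X\times Y$ is a map $\lambda\in\Lambda\mapsto\phi_\lambda\in\Gamma(X)$ such that (1) $\Lambda$ is a non-empty compact topological space; (2) with $f(\lambda,x,y)=\phi_\lambda(x)+\phi_\lambda^*(y)$, for every $x\in X$ the function $f(\cdot,x,\cdot):\Lambda\times Y\to\bar{\mathbb{R}}$ is lower semicontinuous on the product space $\Lambda\times Y$, and for every $y\in Y$ the function $f(\cdot,\cdot,y):\Lambda\times X\to\bar{\mathbb{R}}$ is lower semicontinuous on the product space $\Lambda\times X$; (3) $M=\bigcup_{\lambda\in\Lambda}M(\phi_\lambda)$. Convexity in the sense of Fan: for non-empty sets $A,B$, a function $F:A\times B\to\mathbb{R}$ is convex on $A$ in the sense of Fan if for all $a_1,a_2\in A$ and all $\alpha,\beta\in[0,1]$ with $\alpha+\beta=1$ there is $a\in A$ such that for all $c\in B$, $F(a,c)\le\alpha F(a_1,c)+\beta F(a_2,c)$. Fan bi-implicitly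 convex cover: a convex lagrangian cover $\lambda\mapsto\phi_\lambda$ (with all $\phi_\lambda,\phi_\lambda^*$ real-valued) is Fan bi-implicitly convex if for every $x\in X$ the function $\Lambda\times X\to\mathbb{R}$, $(\lambda,z)\mapsto\phi_\lambda(x)-\phi_\lambda(z)$, is convex on $\Lambda$ in the sense of Fan, and for every $y\in Y$ the function $\Lambda\times Y\to\mathbb{R}$, $(\lambda,u)\mapsto\phi_\lambda^*(y)-\phi_\lambda^*(u)$, is convex on $\Lambda$ in the sense of Fan. *)

(* Defs.v *)
From HB Require Import structures.
From mathcomp Require Import all_boot all_order all_algebra.
From mathcomp Require Import sesquilinear.
From mathcomp Require Import all_classical all_reals all_analysis.

Set Implicit Arguments.
Unset Strict Implicit.
Unset Printing Implicit Defensive.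

Import Order.TTheory GRing.Theory Num.Theory.
Import numFieldNormedType.Exports.

Local Open Scope classical_set_scope.
Local Open Scope ring_scope.
Local Open Scope ereal_scope.

(* Spaces in duality through [dual : X -> Y -> R].  The notions needed on both
   sides are defined for an arbitrary pairing and used on Y through the flipped
   pairing [fun y x => dual x y].  No Hausdorff assumption is made on X or Y.
   Functions with values in R U {+oo} are functions to [\bar R] that avoid
   -oo; when that matters, it is part of the predicate. *)

Definition duality (R : realType) (X Y : tvsType R) (dual : X -> Y -> R) :
    Prop :=
  [/\ bilinear_for *%R *%R dual,
      [set f : X -> R | scalar f /\ continuous f]
        = [set f : X -> R | exists y : Y, f = dual ^~ y]
    & [set g : Y -> R | scalar g /\ continuous g]
        = [set g : Y -> R | exists x : X, g = dual x]].

Definition econvex (R : realType) (E : lmodType R) (phi : E -> \bar R) : Prop :=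
  forall (x z : E) (t : R), (0 <= t)%R -> (t <= 1)%R ->
    phi (t *: x + (1 - t) *: z)%R <= t%:E * phi x + (1 - t)%R%:E * phi z.

Definition Gamma (R : realType) (E : tvsType R) : set (E -> \bar R) :=
  [set phi | [/\ forall x, phi x != -oo, econvex phi
               & lower_semicontinuous phi]].

Definition Gamma0 (R : realType) (E : tvsType R) : set (E -> R) :=
  [set phi | Gamma (EFin \o phi)].

Definition fenchel (R : realType) (X Y : Type) (dual : X -> Y -> R)
    (phi : X -> \bar R) (y : Y) : \bar R :=
  ereal_sup [set (dual x y)%:E - phi x | x in [set: X]].

(* Empty outside of the domain of [phi]. *)
Definition subdiff (R : realType) (X : zmodType) (Y : Type)
    (dual : X -> Y -> R) (phi : X -> \bar R) (x : X) : set Y :=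
  [set u | phi x != +oo /\
           forall z : X, (dual (z - x)%R u)%:E <= phi z - phi x].

(* For an improper [phi] (constantly +oo) the conjugate is constantly -oo and
   the library sets +oo + -oo = -oo, so such a [phi] has an empty graph; for a
   proper [phi] neither summand is -oo. *)
Definition lagrangian (R : realType) (X Y : Type) (dual : X -> Y -> R)
    (phi : X -> \bar R) : set (X * Y) :=
  [set p | phi p.1 + fenchel dual phi p.2 = (dual p.1 p.2)%:E].

Definition BB_graph (R : realType) (X Y : tvsType R) (M : set (X * Y)) : Prop :=
  let m x := [set y : Y | M (x, y)] in
  let mstar y := [set x : X | M (x, y)] in
  [/\ M !=set0,
      forall x, m x !=set0 -> convex_set (m x) /\ closed (m x)
    & forall y, mstar y !=set0 -> convex_set (mstar y) /\ closed (mstar y)].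

Definition bipotential (R : realType) (X Y : tvsType R) (dual : X -> Y -> R)
    (b : X -> Y -> \bar R) : Prop :=
  [/\ (forall y, Gamma (b ^~ y)) /\ (forall x, Gamma (b x)),
      forall x y, (dual x y)%:E <= b x y
    & forall x y,
        (subdiff dual (b ^~ y) x y <->
           subdiff (fun y' x' => dual x' y') (b x) y x) /\
        (subdiff (fun y' x' => dual x' y') (b x) y x <->
           b x y = (dual x y)%:E)].

Definition bipotential_graph (R : realType) (X Y : Type) (dual : X -> Y -> R)
    (b : X -> Y -> \bar R) : set (X * Y) :=
  [set p | b p.1 p.2 = (dual p.1 p.2)%:E].

Definition convex_lagrangian_cover (R : realType) (X Y : tvsType R)
    (dual : X -> Y -> R) (Lam : topologicalType) (M : set (X * Y))
    (phi : Lam -> X -> \bar R) : Prop :=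
  let f l x y := phi l x + fenchel dual (phi l) y in
  [/\ forall l, Gamma (phi l),
      [set: Lam] !=set0 /\ compact [set: Lam],
      forall x, lower_semicontinuous (fun p : Lam * Y => f p.1 x p.2),
      forall y, lower_semicontinuous (fun p : Lam * X => f p.1 p.2 y)
    & M = \bigcup_(l in [set: Lam]) lagrangian dual (phi l)].

Definition fan_convex (R : realType) (A B : Type) (F : A -> B -> R) : Prop :=
  forall (a1 a2 : A) (alpha beta : R),
    (0 <= alpha <= 1)%R -> (0 <= beta <= 1)%R -> (alpha + beta = 1)%R ->
    exists a : A, forall c : B,
      (F a c <= alpha * F a1 c + beta * F a2 c)%R.

(* For real-valued [phi l] whose conjugates are also real-valued: [fine] is
   then just the identification of finite extended reals with reals. *)
Definition fan_bi_implicitly_convex (R : realType) (X Y : Type)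
    (dual : X -> Y -> R) (Lam : Type) (phi : Lam -> X -> R) : Prop :=
  let phistar l y := fine (fenchel dual (EFin \o phi l) y) in
  (forall x, fan_convex (fun l z => phi l x - phi l z)%R) /\
  (forall y, fan_convex (fun l u => phistar l y - phistar l u)%R).

Definition cover_inf (R : realType) (X Y Lam : Type) (dual : X -> Y -> R)
    (phi : Lam -> X -> \bar R) (x : X) (y : Y) : \bar R :=
  ereal_inf [set phi l x + fenchel dual (phi l) y | l in [set: Lam]].

(* Main.v *)
(** Compactness makes the infimum defining [b] attained and lower
    semicontinuous in each variable.  Convexity of [b x] needs no minimax
    theorem: [phi l x + phi* l y] is the supremum over [z] of
    [phi l x - phi l z + <z, y>], so Fan convexity of the first difference in
    [l] passes directly to convex combinations of [y].  The other variable is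
    treated by the same argument applied to [phi* l], whose conjugate is
    [phi l] by the Fenchel-Moreau theorem; the latter rests on the Hahn-Banach
    theorem, obtained from the fact that a minimal sublinear functional is
    linear.  A subgradient relation at [(x, y)] forces [b x y <= <x, y>]
    because the infimum over [z] of [phi l z + phi* l y - <z, y>] is [0]. *)

Require Import Defs.
From HB Require Import structures.
From mathcomp Require Import all_boot all_order all_algebra.
From mathcomp Require Import all_classical all_reals all_analysis.
From mathcomp Require Import lra.
Import Order.TTheory GRing.Theory Num.Theory.
Import numFieldNormedType.Exports.
Local Open Scope classical_set_scope.
Local Open Scope ring_scope.

Set Implicit Arguments.
Unset Strict Implicit.
Unset Printing Implicit Defensive.

(** * Linear and sublinear functionals, Hahn-Banach *)

Lemma scalar_fctB (R : realType) (V : lmodType R) (f : V -> R) (u v : V) :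
  scalar f -> f (u - v) = f u - f v.
Proof. by move=> sf; rewrite addrC -scaleN1r sf /= mulN1r addrC. Qed.

Lemma scalar_fctZ (R : realType) (V : lmodType R) (f : V -> R) (a : R) (v : V) :
  scalar f -> f (a *: v) = a * f v.
Proof.
move=> sf; have f0 : f 0 = 0 by rewrite -(subrr (0 : V)) scalar_fctB // subrr.
by rewrite -[a *: v]addr0 sf f0 addr0.
Qed.

(** Homogeneity is asked only as an inequality, which infima inherit directly; equality follows by
    scaling back with [t^-1]. *)
Definition sublinear (R : realType) (V : lmodType R) (p : V -> R) : Prop :=
  (forall v w, p (v + w) <= p v + p w) /\
  (forall t v, 0 <= t -> p (t *: v) <= t * p v).

Lemma sublinearZ (R : realType) (V : lmodType R) (p : V -> R) (t : R) (v : V) :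
  sublinear p -> 0 <= t -> p (t *: v) = t * p v.
Proof.
move=> [pD pZ]; rewrite le_eqVlt => /predU1P[<-|t0].
  rewrite scale0r mul0r; apply/le_anti/andP; split.
    by rewrite -[leRHS](mul0r (p v)) -(scale0r v) pZ.
  by have := pD 0 0; rewrite addr0; lra.
apply/le_anti/andP; split; first by rewrite pZ // ltW.
have := pZ t^-1 (t *: v); rewrite invr_ge0 scalerA mulVf ?gt_eqF // scale1r.
by move/(_ (ltW t0)); rewrite mulrC ler_pdivlMr // mulrC.
Qed.

Lemma sublinear_ge (R : realType) (V : lmodType R) (p : V -> R) (v : V) :
  sublinear p -> - p (- v) <= p v.
Proof.
move=> sp; have := sublinearZ 0 sp (lexx _); rewrite scale0r mul0r.
by have := sp.1 v (- v); rewrite subrr; lra.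
Qed.

(** Covers the three infima used below: along a ray, over a chain, and over decompositions of a
    vector. Closure of the sets [S v] under sums and scaling is needed only up to a smaller
    element. *)
Lemma sublinear_inf (R : realType) (V : lmodType R) (S : V -> set R) :
  (forall v, S v !=set0) -> (forall v, has_lbound (S v)) ->
  (forall v w a b, S v a -> S w b -> exists2 c, S (v + w) c & c <= a + b) ->
  (forall t v a, 0 <= t -> S v a -> exists2 c, S (t *: v) c & c <= t * a) ->
  sublinear (fun v => inf (S v)).
Proof.
move=> S0 Slb SD SZ; split.
  move=> v w /=; rewrite -lerBlDr; apply: lb_le_inf => // a Sa.
  rewrite lerBlDr -lerBlDl; apply: lb_le_inf => // b Sb.
  rewrite lerBlDl; have [c Sc] := SD _ _ _ _ Sa Sb.
  by apply: le_trans; apply: ge_inf.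
move=> t v t0 /=.
have le_inf a : S v a -> inf (S (t *: v)) <= t * a.
  move=> Sa; have [c Sc] := SZ _ _ _ t0 Sa.
  by apply: le_trans; apply: ge_inf.
have [<-|t_neq0] := eqVneq 0 t.
  have [a Sa] := S0 v; rewrite mul0r.
  have [c Sc] := SZ _ _ _ (lexx 0) Sa; rewrite mul0r; apply: le_trans.
  exact: ge_inf.
have t_gt0 : 0 < t by rewrite lt_neqAle t_neq0.
rewrite mulrC -ler_pdivrMr //; apply: lb_le_inf => // a Sa.
by rewrite ler_pdivrMr // mulrC le_inf.
Qed.

(* For fixed [u], the functional [v |-> inf_(t >= 0) (p (v + t u) - t p u)] is
   sublinear and below [p]; when [p] is minimal it equals [p], and [t = 1] gives
   [p v + p u <= p (v + u)]. *)
Lemma minimal_sublinear_scalar (R : realType) (V : lmodType R) (p : V -> R) :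
  sublinear p ->
  (forall q, sublinear q -> (forall v, q v <= p v) -> q = p) ->
  scalar p.
Proof.
move=> sp pmin.
have pD u v : p (v + u) = p v + p u.
  apply/le_anti; rewrite sp.1 /=.
  pose S v := [set p (v + t *: u) - t * p u | t in [set t | 0 <= t]].
  have Slb w : has_lbound (S w).
    exists (- p (- w)) => _ [t t0 <-].
    have := sp.1 (w + t *: u) (- w).
    by rewrite addrAC subrr add0r (sublinearZ _ sp t0); lra.
  have sq : sublinear (fun v => inf (S v)).
    apply: sublinear_inf => //.
    - by move=> w; exists (p (w + 0 *: u) - 0 * p u), 0 => /=.
    - move=> v1 v2 _ _ [t1 t10 <-] [t2 t20 <-].
      exists (p (v1 + v2 + (t1 + t2) *: u) - (t1 + t2) * p u).
        by exists (t1 + t2) => //=; rewrite addr_ge0.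
      have := sp.1 (v1 + t1 *: u) (v2 + t2 *: u).
      by rewrite addrACA -scalerDl; lra.
    - move=> s w _ s0 [t t0 <-].
      exists (p (s *: w + (s * t) *: u) - (s * t) * p u).
        by exists (s * t) => //=; rewrite mulr_ge0.
      have := sp.2 s (w + t *: u) s0.
      by rewrite scalerDr scalerA; lra.
  have qp : (fun v => inf (S v)) = p.
    apply: pmin => // w; apply: ge_inf => //.
    by exists 0 => //=; rewrite scale0r addr0 mul0r subr0.
  have : inf (S v) <= p (v + 1 *: u) - 1 * p u.
    by apply: ge_inf => //; exists 1 => //=.
  by rewrite scale1r mul1r -[inf _]/((fun v => inf (S v)) v) qp; lra.
have p0 : p 0 = 0 by have := pD 0 0; rewrite addr0; lra.
have pN v : p (- v) = - p v by have := pD (- v) v; rewrite subrr p0; lra.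
move=> a u v; rewrite pD; congr (_ + _).
have [a0|a0] := leP 0 a; first exact: sublinearZ.
by rewrite -[a]opprK scaleNr pN (sublinearZ _ sp) ?mulNr //; lra.
Qed.

(** Zorn's lemma on the sublinear functionals below [p], with the order reversed so that a maximal
    element is pointwise minimal, hence linear. A chain is bounded by its pointwise infimum, finite
    because each member is at least [- p (- v)] at [v]. *)
Lemma hahn_banach_sublinear (R : realType) (V : lmodType R) (p : V -> R) :
  sublinear p -> exists2 l : V -> R, scalar l & forall v, l v <= p v.
Proof.
move=> sp.
pose T := {q : V -> R | sublinear q /\ forall v, q v <= p v}.
pose r (q1 q2 : T) := `[< forall v, sval q2 v <= sval q1 v >].
have [||||q qmax] := @Zorn T r.
- by move=> q; apply/asboolP.
- move=> q1 q2 q3 /asboolP q12 /asboolP q23; apply/asboolP => v.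
  exact: le_trans (q23 v) (q12 v).
- move=> q1 q2 /asboolP q12 /asboolP q21; apply: eq_sig_hprop.
    by move=> *; exact: Prop_irrelevance.
  by apply/funext => v; apply/le_anti; rewrite q12 q21.
- move=> A totA; have [A0|/set0P[q0 Aq0]] := eqVneq A set0.
    have pp : sublinear p /\ forall v, p v <= p v by split.
    by exists (exist _ p pp) => q; rewrite A0.
  pose S v := [set sval q v | q in A].
  have Slb w : has_lbound (S w).
    exists (- p (- w)) => _ [q Aq <-].
    have [sq qp] := svalP q.
    by have := sublinear_ge w sq; have := qp (- w); lra.
  have sq : sublinear (fun v => inf (S v)).
    apply: sublinear_inf => //.
    - by move=> w; exists (sval q0 w), q0.
    - move=> v1 v2 _ _ [q1 Aq1 <-] [q2 Aq2 <-].
      (* The smaller of the two chain members serves both summands. *)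
      have [/asboolP q21|/asboolP q12] := totA _ _ Aq1 Aq2.
      + exists (sval q2 (v1 + v2)); first by exists q2.
        have := (svalP q2).1.1 v1 v2; have := q21 v1; lra.
      + exists (sval q1 (v1 + v2)); first by exists q1.
        have := (svalP q1).1.1 v1 v2; have := q12 v2; lra.
    - move=> s w _ s0 [q Aq <-].
      exists (sval q (s *: w)); first by exists q.
      by apply: (svalP q).1.2.
  have qp v : inf (S v) <= p v.
    apply: le_trans ((svalP q0).2 v).
    by apply: ge_inf => //; exists q0.
  pose t : T := exist _ (fun v => inf (S v)) (conj sq qp).
  exists t => q Aq; apply/asboolP => v /=.
  by apply: ge_inf => //; exists q.
have [sq qp] := svalP q.
exists (sval q) => //; apply: minimal_sublinear_scalar => // q' sq' q'q.
have q'p v : q' v <= p v by apply: le_trans (qp v).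
pose t : T := exist _ q' (conj sq' q'p).
by apply: (congr1 sval (qmax t _)); apply/asboolP.
Qed.

(* [p v = inf {t (phi w - r) + (phi 0 - r) s | v = t w + s u, u \in V}] is the
   largest sublinear functional below [phi - r] everywhere and below
   [phi 0 - r] on [V]. *)
Lemma convex_affine_minorant (R : realType) (E : lmodType R) (phi : E -> R)
    (V : set E) (r : R) :
  (forall x z t, 0 <= t -> t <= 1 ->
     phi (t *: x + (1 - t) *: z) <= t * phi x + (1 - t) * phi z) ->
  V 0 -> (forall v, V v -> V (- v)) ->
  (forall x z t, 0 <= t -> t <= 1 -> V x -> V z ->
     V (t *: x + (1 - t) *: z)) ->
  (forall v, exists c u, [/\ 0 <= c, V u & v = c *: u]) ->
  (forall v, V v -> r < phi v) ->
  exists l : E -> R, [/\ scalar l, forall v, l v <= phi v - r &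
    forall v, V v -> l v <= phi 0 - r].
Proof.
move=> cphi V0 VN cV absV rphi.
set N := phi 0 - r.
have N0 : 0 < N by rewrite subr_gt0 rphi.
have weightE (a b : R) : a + b != 0 ->
    ((a + b) * (a / (a + b)) = a) * ((a + b) * (1 - a / (a + b)) = b).
  move=> ab0; have abE : (a + b) * (a / (a + b)) = a.
    by rewrite mulrCA mulfV // mulr1.
  by split => //; rewrite mulrBr abE; lra.
have convV a b x z : 0 <= a -> 0 <= b -> V x -> V z ->
    exists2 y, V y & a *: x + b *: z = (a + b) *: y.
  move=> a0 b0 Vx Vz; have [ab0|ab0] := eqVneq (a + b) 0.
    have [-> ->] : a = 0 /\ b = 0 by split; lra.
    by exists 0 => //; rewrite !scale0r scaler0 addr0.
  exists ((a / (a + b)) *: x + (1 - a / (a + b)) *: z).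
    apply: cV => //; first by rewrite divr_ge0 // addr_ge0.
    by rewrite ler_pdivrMr ?mul1r ?lerDl // lt_neqAle eq_sym ab0 addr_ge0.
  by rewrite scalerDr !scalerA !weightE.
(* Subadditivity of the perspective of [phi - r], with weights normalised by [a + b]. *)
have phi_persp a b x z : 0 <= a -> 0 <= b ->
    exists2 y, (a + b) * (phi y - r) <= a * (phi x - r) + b * (phi z - r)
      & a *: x + b *: z = (a + b) *: y.
  move=> a0 b0; have [ab0|ab0] := eqVneq (a + b) 0.
    have [-> ->] : a = 0 /\ b = 0 by split; lra.
    by exists 0; rewrite ?scale0r ?scaler0 ?addr0 // !mul0r addr0.
  have ab_gt0 : 0 < a + b by rewrite lt_neqAle eq_sym ab0 addr_ge0.
  exists ((a / (a + b)) *: x + (1 - a / (a + b)) *: z); last first.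
    by rewrite scalerDr !scalerA !weightE.
  have := cphi x z (a / (a + b)).
  rewrite divr_ge0 ?(ltW ab_gt0) // ler_pdivrMr // mul1r lerDl b0.
  move=> /(_ isT isT) /(ler_wpM2l (ltW ab_gt0)).
  rewrite mulrDr [X in _ <= X + _]mulrA [X in _ <= _ + X]mulrA !weightE //.
  by rewrite !mulrBr mulrDl; lra.
pose S v := [set e | exists t w s u, [/\ 0 <= t, 0 <= s, V u,
  v = t *: w + s *: u & e = t * (phi w - r) + N * s]].
have Slb v : has_lbound (S v).
  (* Writing [v] as [c *: v0] with [v0] in [V] makes [t *: w] equal to [c + s] times a point [u'] of
     [V]. *)
  have [c [v0 [c0 Vv0 vE]]] := absV v.
  exists (- (c * N)) => _ [t [w [s [u [t0 s0 Vu vE' ->]]]]].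
  have [u' Vu' twE] : exists2 u', V u' & t *: w = (c + s) *: u'.
    have [u' Vu' u'E] := convV c s v0 (- u) c0 s0 Vv0 (VN _ Vu).
    by exists u' => //; rewrite -u'E -vE vE' scalerN addrK.
  have [->|t_neq0] := eqVneq t 0; first by nra.
  have t_gt0 : 0 < t by rewrite lt_neqAle eq_sym t_neq0.
  have wE : w = ((c + s) / t) *: u'.
    by rewrite mulrC -scalerA -twE scalerA mulVf // scale1r.
  (* If [(c + s) / t <= 1], then [w] lies between [0] and [u'], hence in [V], where [phi] exceeds
     [r]. *)
  have [kt|kt] := leP ((c + s) / t) 1.
    have : r < phi w.
      apply: rphi; rewrite wE -[_ *: u']addr0 -(scaler0 _ (1 - (c + s) / t)).
      by apply: cV => //; rewrite divr_ge0 // addr_ge0.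
    by nra.
  (* Otherwise [u'] lies between [0] and [w], and convexity carries [r < phi u'] over to a lower
     bound on [phi w]. *)
  have cs_gt0 : t < c + s by move: kt; rewrite ltr_pdivlMr // mul1r.
  have cs0 : c + s != 0 by lra.
  have := cphi w 0 (t / (c + s)).
  rewrite divr_ge0 ?addr_ge0 // ler_pdivrMr ?mul1r ?(ltW cs_gt0); last by lra.
  move=> /(_ isT isT); rewrite scaler0 addr0 wE scalerA.
  rewrite (_ : t / (c + s) * ((c + s) / t) = 1); last first.
    by rewrite mulrA divfK // mulfV.
  rewrite -wE scale1r => phiu'.
  have := lt_le_trans (rphi _ Vu') phiu'.
  rewrite -(ltr_pM2l (_ : 0 < c + s)); last by lra.
  have tE : (c + s) * (t / (c + s)) = t by rewrite mulrCA mulfV // mulr1.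
  rewrite mulrDr [X in _ < X + _]mulrA [X in _ < _ + X]mulrA mulrBr mulr1 tE.
  have : 0 <= t * N by rewrite mulr_ge0 // ltW.
  by rewrite /N; lra.
have Sphi v : S v (phi v - r).
  exists 1, v, 0, 0; split => //; first by rewrite scale1r scaler0 addr0.
  by rewrite mul1r mulr0 addr0.
have sp : sublinear (fun v => inf (S v)).
  apply: sublinear_inf => //.
  - by move=> v; exists (phi v - r).
  - move=> v1 v2 _ _ [t1 [w1 [s1 [u1 [t10 s10 Vu1 -> ->]]]]]
      [t2 [w2 [s2 [u2 [t20 s20 Vu2 -> ->]]]]].
    have [w wle wE] := phi_persp t1 t2 w1 w2 t10 t20.
    have [u Vu uE] := convV s1 s2 u1 u2 s10 s20 Vu1 Vu2.
    exists ((t1 + t2) * (phi w - r) + N * (s1 + s2)); last by lra.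
    exists (t1 + t2), w, (s1 + s2), u; split => //; rewrite ?addr_ge0 //.
    by rewrite addrACA wE uE.
  - move=> a v _ a0 [t [w [s [u [t0 s0 Vu -> ->]]]]].
    exists (a * t * (phi w - r) + N * (a * s)); last by lra.
    exists (a * t), w, (a * s), u; split => //; rewrite ?mulr_ge0 //.
    by rewrite scalerDr !scalerA.
have [l sl lp] := hahn_banach_sublinear sp.
exists l; split => // v.
  by apply: le_trans (lp v) _; apply: ge_inf.
move=> Vv; apply: le_trans (lp v) _; apply: ge_inf => //.
exists 0, 0, 1, v; split => //; first by rewrite scale0r add0r scale1r.
by rewrite mul0r add0r mulr1.
Qed.

(** * Neighbourhoods of zero and continuous affine minorants *)

(** A convex basic neighbourhood is intersected with its reflection; symmetry later turns an upper
    bound on a linear functional into a two-sided one. *)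
Lemma nbhs0_absconvex (R : realType) (E : tvsType R) (U : set E) :
  nbhs (0 : E) U -> exists V : set E, [/\ nbhs (0 : E) V, V `<=` U,
    forall v, V v -> V (- v) &
    forall x z t, 0 <= t -> t <= 1 -> V x -> V z ->
      V (t *: x + (1 - t) *: z)].
Proof.
have [B Bconv [Bopen Bnbhs]] := @locally_convex R E => /Bnbhs[C [BC C0] CU].
have CE x z t : 0 <= t -> t <= 1 -> C x -> C z -> C (t *: x + (1 - t) *: z).
  move=> t0 t1 Cx Cz.
  have t01 : Itv.spec (@Itv.num_sem R) (Itv.Real `[0%Z, 1%Z]) t.
    apply/and3P; split; rewrite ?num_real //= bnd_simp //.
  have := Bconv C _ x z (Itv.mk t01); rewrite !inE.
  by apply.
have nC : nbhs (0 : E) C by apply: open_nbhs_nbhs; split => //; exact: Bopen.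
exists (C `&` [set v | C (- v)]); split.
- apply: filterI => //.
  have := nbhs0N nC; congr (nbhs _ _); apply/seteqP; split => v /=.
    by move=> [w Cw <-]; rewrite opprK.
  by move=> CNv; exists (- v) => //; rewrite opprK.
- by move=> v [/CU].
- by move=> v [? ?]; split => //=; rewrite opprK.
- move=> x z t t0 t1 [Cx CNx] [Cz CNz]; split; first exact: CE.
  by rewrite /= opprD -!scalerN; exact: CE.
Qed.

Lemma nbhs0_absorbing (R : realType) (E : tvsType R) (V : set E) (v : E) :
  nbhs (0 : E) V -> exists c u, [/\ 0 <= c, V u & v = c *: u].
Proof.
move=> V0.
have cv : (fun t : R => t *: v) @ (0 : R) --> (0 : R) *: v.
  apply: (@continuous_comp _ _ _ (fun t : R => (t : R^o, v))
    (fun z : R^o * E => z.1 *: z.2)); last exact: scale_continuous.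
  exact: (@cvg_pair _ _ _ (nbhs (0 : R)) (nbhs (0 : R^o)) (nbhs v) _ _ _
    (fun t => t) (fun=> v) cvg_id (cvg_cst _)).
rewrite scale0r in cv.
have /cv/nbhs_ballP[e /= e0 eV] := V0.
exists (e / 2)^-1, ((e / 2) *: v); split.
- by rewrite invr_ge0 divr_ge0 // ltW.
- apply: eV; rewrite /ball/= sub0r normrN ger0_norm ?divr_ge0 ?ltW //.
  by rewrite ltr_pdivrMr // ltr_pMr // ltr1n.
- by rewrite scalerA mulVf ?scale1r // mulf_neq0 ?gt_eqF // invr_gt0.
Qed.

Lemma scalar_bounded_continuous (R : realType) (E : tvsType R) (l : E -> R)
    (V : set E) (N : R) : scalar l -> nbhs (0 : E) V ->
  (forall v, V v -> `|l v| <= N) -> continuous l.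
Proof.
move=> sl V0 lN x.
have l0 : l 0 = 0 by rewrite -(scale0r (0 : E)) (@scalar_fctZ _ _ l) // mul0r.
apply/cvgrPdist_lt => e e0.
have N0 : 0 <= N by have := lN 0 (nbhs_singleton V0); rewrite l0 normr0.
(* Adding [1] keeps the divisor positive when [N] is [0] and makes the final bound strict. *)
pose a := e / (N + 1).
have a0 : 0 < a by rewrite divr_gt0 // ltr_wpDl.
have aV : nbhs x [set x + a *: v | v in V].
  have := nbhsT x (nbhs0Z (lt0r_neq0 a0) V0).
  by rewrite image_comp.
apply: filterS aV => _ [v Vv <-].
rewrite [x + _]addrC sl opprD addrCA subrr addr0 normrN normrM gtr0_norm //.
apply: le_lt_trans (ler_wpM2l (ltW a0) (lN _ Vv)) _.
by rewrite /a mulrAC ltr_pdivrMr ?ltr_wpDl // ltr_pM2l //; lra.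
Qed.

(** Lower semicontinuity keeps [phi] above [r] near [x]. After translating [x] to [0], the algebraic
    minorant applies, and its bound on a symmetric neighbourhood makes it continuous. *)
Lemma Gamma0_affine_minorant (R : realType) (E : tvsType R) (phi : E -> R)
    (x : E) (r : R) : Gamma0 phi -> r < phi x ->
  exists l : E -> R, [/\ scalar l, continuous l &
    forall z, l (z - x) <= phi z - r].
Proof.
move=> [_ cphi lphi] rx.
have [W xW rW] := lphi x r rx.
have nW : nbhs (0 : E) [set v | W (x + v)].
  have := nbhsB (- x) xW; rewrite addNr.
  apply: filterS => _ [w Ww <-] /=.
  by rewrite addrA subrr add0r.
have [V [V0 VW VN cV]] := nbhs0_absconvex nW.
have [||||||l [sl lphi' lV]] :=
  @convex_affine_minorant R E (fun v => phi (x + v)) V r.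
- move=> u v t t0 t1.
  have := cphi (x + u) (x + v) t t0 t1; rewrite /= -!EFinM -EFinD lee_fin.
  apply: le_trans; rewrite le_eqVlt; apply/orP; left; apply/eqP; congr phi.
  by rewrite !scalerDr addrACA -scalerDl [t + _]addrC subrK scale1r.
- exact: nbhs_singleton.
- exact: VN.
- exact: cV.
- by move=> v; exact: nbhs0_absorbing.
- by move=> v /VW/rW; rewrite lte_fin.
exists l; split => //.
  apply: (@scalar_bounded_continuous _ _ _ V (phi (x + 0) - r)) => // v Vv.
  rewrite ler_norml lV // andbT lerNl.
  by rewrite -mulN1r -(@scalar_fctZ _ _ l) // scaleN1r; apply: lV; exact: VN.
by move=> z; have := lphi' (z - x); rewrite [x + _]addrC subrK.
Qed.

(** * Fenchel conjugation *)

(** The conjugate as a least upper bound among reals: no extended arithmetic, and the same shape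
    when [X] and [Y] are exchanged. *)
Definition is_conjugate (R : realType) (X Y : Type) (dual : X -> Y -> R)
    (phi : X -> R) (psi : Y -> R) : Prop :=
  forall y r, psi y <= r <-> forall x, dual x y - phi x <= r.

Lemma fenchel_young (R : realType) (X Y : Type) (dual : X -> Y -> R)
    (phi : X -> R) (psi : Y -> R) (x : X) (y : Y) :
  is_conjugate dual phi psi -> dual x y <= phi x + psi y.
Proof. by move=> /(_ y (psi y))[/(_ (lexx _))/(_ x) + _]; lra. Qed.

Lemma fenchel_is_conjugate (R : realType) (X Y : Type) (dual : X -> Y -> R)
    (phi : X -> R) :
  (forall y, fenchel dual (EFin \o phi) y \is a fin_num) ->
  is_conjugate dual phi (fun y => fine (fenchel dual (EFin \o phi) y)).
Proof.
move=> fin y r; rewrite -lee_fin fineK //; split => [fr x|fr].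
  rewrite -lee_fin EFinB; apply: le_trans fr; apply: ereal_sup_ubound.
  by exists x.
by apply: ge_ereal_sup => _ [x _ <-]; rewrite -EFinB lee_fin.
Qed.

(** If [phi x] exceeded [r], a continuous affine minorant of [phi] with value above [r] at [x] would
    be represented by some [y] violating the bound on [dual x y - psi y]. *)
Lemma fenchel_moreau (R : realType) (X Y : tvsType R) (dual : X -> Y -> R)
    (phi : X -> R) (psi : Y -> R) :
  duality dual -> Gamma0 phi -> is_conjugate dual phi psi ->
  is_conjugate (fun y x => dual x y) psi phi.
Proof.
move=> [[duall _] dualX _] Gphi conj x r; split => [phir y|].
  by have := fenchel_young x y conj; lra.
apply: contraPP => /negP; rewrite -ltNge => rphi.
(* The midpoint is strictly below [phi x], as the minorant requires, and strictly above [r], for the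
   contradiction. *)
have [l [sl cl lphi]] := @Gamma0_affine_minorant R X phi x ((r + phi x) / 2)
  Gphi ltac:(lra).
have [y lE] : [set f : X -> R | exists y : Y, f = dual ^~ y] l.
  by rewrite -dualX.
have dualB z : dual (z - x) y = dual z y - dual x y.
  exact: (@scalar_fctB R X (dual ^~ y)).
have psiy : psi y <= dual x y - (r + phi x) / 2.
  by apply/conj => z; have := lphi z; rewrite lE dualB; lra.
by move=> /(_ y); lra.
Qed.

(** * Infima over the index of a cover *)

(** A tube argument: by compactness, the bounds [c < g] near each [(k, t)] combine into one
    neighbourhood of [t] valid for all [k]. *)
Lemma lower_semicontinuous_inf (R : realType) (K T : topologicalType)
    (g : K * T -> \bar R) :
  compact [set: K] -> lower_semicontinuous g ->
  lower_semicontinuous (fun t => ereal_inf [set g (k, t) | k in [set: K]]).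
Proof.
move=> /compact_near_coveringP cK lg t a ainf.
(* An infimum of values above [c] is only known to be at least [c], so [c] is taken strictly above
   [a]. *)
have [c ac cinf] : exists2 c : R, a < c &
    (c%:E < ereal_inf [set g (k, t) | k in [set: K]])%E.
  move: ainf; case: (ereal_inf _) => [s| |] //; last first.
    by exists (a + 1); rewrite ?ltrDl // ltry.
  by rewrite lte_fin => als; exists ((a + s) / 2); rewrite ?lte_fin; lra.
exists [set u | [set: K] `<=` [set k | (c%:E < g (k, u))%E]].
  apply: cK => k _.
  have [|V kV gV] := lg (k, t) c.
    by apply: lt_le_trans cinf _; apply: ereal_inf_lbound; exists k.
  by apply: filterS kV => -[k' u] /gV.
move=> u cu; apply: (@lt_le_trans _ _ c%:E); rewrite ?lte_fin //.
by apply: le_ereal_inf_tmp => _ [k _ <-]; apply: ltW; exact: cu.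
Qed.

Section inf_cover.
Context (R : realType) (X Y : lmodType R) (Lam : Type) (dual : X -> Y -> R)
  (phi : Lam -> X -> R) (psi : Lam -> Y -> R) (b : X -> Y -> R).
Hypothesis conj : forall l, is_conjugate dual (phi l) (psi l).
Hypothesis b_le : forall x y l, b x y <= phi l x + psi l y.

(* [phi l x + psi l y] is the supremum over [z] of
   [phi l x - phi l z + dual z y], so the index given by Fan convexity for two
   points [y1], [y2] bounds it at every convex combination of them. *)
Lemma fan_cover_convex (x : X) (y1 y2 : Y) (t : R) :
  (forall z, scalar (dual z)) ->
  fan_convex (fun l z => phi l x - phi l z) ->
  (forall y, exists l, b x y = phi l x + psi l y) ->
  0 <= t -> t <= 1 ->
  b x (t *: y1 + (1 - t) *: y2) <= t * b x y1 + (1 - t) * b x y2.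
Proof.
move=> dualr fan b_min t0 t1.
have [l1 ->] := b_min y1; have [l2 ->] := b_min y2.
have [|||l lP] := fan l1 l2 t (1 - t); rewrite ?t0 ?t1 //; try lra.
apply: le_trans (b_le _ _ l) _; rewrite -lerBrDl.
apply/conj => z; have := lP z.
rewrite dualr /= (@scalar_fctZ _ _ (dual z)) //.
have /(ler_wpM2l t0) := fenchel_young z y1 (conj l1).
have /(ler_wpM2l (_ : 0 <= 1 - t)) :=
  fenchel_young z y2 (conj l2).
by move=> /(_ ltac:(lra)); lra.
Qed.

(** Any single index suffices: [b z y <= phi l z + psi l y] turns the subgradient inequality into a
    bound on all [dual z y - phi l z], hence on [psi l y]. *)
Lemma cover_subgradient (x : X) (y : Y) (l : Lam) : scalar (dual ^~ y) ->
  (forall z, dual (z - x) y <= b z y - b x y) -> b x y <= dual x y.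
Proof.
move=> duall sub.
have dualB z : dual (z - x) y = dual z y - dual x y.
  exact: (@scalar_fctB R X (dual ^~ y)).
suff : psi l y <= psi l y + dual x y - b x y by lra.
by apply/conj => z; have := sub z; have := b_le z y l; rewrite dualB; lra.
Qed.

End inf_cover.

(** * Bipotential of a Fan bi-implicitly convex cover *)

Theorem theorem4p4 (R : realType) (X Y : tvsType R) (dual : X -> Y -> R)
    (Hdual : duality dual)
    (M : set (X * Y)) (HM : BB_graph M)
    (Lam : topologicalType)
    (Lam_compact : compact [set: Lam]) (Lam_hausdorff : hausdorff_space Lam)
    (phi : Lam -> X -> R)
    (phi_Gamma0 : forall l, Gamma0 (phi l))
    (phi_cover : convex_lagrangian_cover dual M (fun l => EFin \o phi l))
    (phistar_real : forall l y, fenchel dual (EFin \o phi l) y \is a fin_num)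
    (phi_cont : forall x, continuous (fun l => phi l x))
    (phistar_cont : forall y,
      continuous (fun l => fine (fenchel dual (EFin \o phi l) y)))
    (phi_fan : fan_bi_implicitly_convex dual phi) :
  let b := cover_inf dual (fun l => EFin \o phi l) in
  [/\ forall x y, b x y \is a fin_num,
      bipotential dual b
    & M = bipotential_graph dual b].
Proof.
move=> b.
pose psi l y := fine (fenchel dual (EFin \o phi l) y).
have conj l : is_conjugate dual (phi l) (psi l).
  exact: fenchel_is_conjugate.
(* With both conjugacy relations, each one-sided lemma also applies with [X] and [Y] exchanged. *)
have conj' l : is_conjugate (fun y x => dual x y) (psi l) (phi l).
  exact: fenchel_moreau.
have fE l x y : ((phi l x)%:E + fenchel dual (EFin \o phi l) y)%E =
    (phi l x + psi l y)%:E.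
  by rewrite EFinD fineK.
have [_ [[l0 _] _] lscY lscX ME] := phi_cover.
have b_min x y : exists2 l, b x y = (phi l x + psi l y)%:E &
    forall l', phi l x + psi l y <= phi l' x + psi l' y.
  have [|||l _ lmin] :=
    @compact_EVT_min Lam R (fun l => phi l x + psi l y) setT.
  - by exists l0.
  - exact: Lam_compact.
  - apply: continuous_subspaceT => l.
    by apply: cvgD; [exact: phi_cont|exact: phistar_cont].
  have lP l' : phi l x + psi l y <= phi l' x + psi l' y.
    by apply: lmin; rewrite inE.
  exists l => //; apply/le_anti/andP; split.
    by apply: ereal_inf_lbound; exists l => //=; rewrite fE.
  by apply: le_ereal_inf_tmp => _ [l' _ <-] /=; rewrite fE lee_fin.
pose B x y := fine (b x y).
have bE x y : b x y = (B x y)%:E by rewrite /B; have [l -> _] := b_min x y.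
have B_le x y l : B x y <= phi l x + psi l y.
  by rewrite /B; have [l' -> /=] := b_min x y; apply.
have B_min x y : exists l, B x y = phi l x + psi l y.
  by rewrite /B; have [l -> _] := b_min x y; exists l.
have dual_le x y : dual x y <= B x y.
  by have [l ->] := B_min x y; exact: fenchel_young.
have [[duall dualr] _ _] := Hdual.
have [fanX fanY] := phi_fan.
have cvxY x : econvex (b x).
  move=> y1 y2 t t0 t1; rewrite !bE -!EFinM -EFinD lee_fin.
  exact: (@fan_cover_convex R X Y Lam dual phi psi).
have cvxX y : econvex (b ^~ y).
  move=> x1 x2 t t0 t1; rewrite !bE -!EFinM -EFinD lee_fin.
  apply: (@fan_cover_convex R Y X Lam (fun y x => dual x y) psi phi
    (fun y x => B x y)) => //.
  - by move=> *; rewrite addrC.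
  - exact: fanY.
  - by move=> x; have [l ->] := B_min x y; exists l; rewrite addrC.
have subX x y : subdiff dual (b ^~ y) x y <-> b x y = (dual x y)%:E.
  split=> [[_ sub]|bxy].
    rewrite bE; congr EFin; apply/le_anti; rewrite dual_le andbT.
    apply: (@cover_subgradient R X Y Lam dual phi psi) => // z.
    by have := sub z; rewrite !bE -EFinB lee_fin.
  (* Where [b] touches the duality product, [dual z y <= b z y] is itself the subgradient
     inequality. *)
  split=> [|z]; first by rewrite bE.
  have -> : dual (z - x) y = dual z y - dual x y.
    exact: (@scalar_fctB R X (dual ^~ y)).
  by rewrite bxy bE -EFinB lee_fin lerB.
have subY x y : subdiff (fun y' x' => dual x' y') (b x) y x <->
    b x y = (dual x y)%:E.
  split=> [[_ sub]|bxy].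
    rewrite bE; congr EFin; apply/le_anti; rewrite dual_le andbT.
    apply: (@cover_subgradient R Y X Lam (fun y x => dual x y) psi phi
      (fun y x => B x y)) => //.
    - by move=> *; rewrite addrC.
    - by move=> z; have := sub z; rewrite !bE -EFinB lee_fin.
  split=> [|z]; first by rewrite bE.
  have -> : dual x (z - y) = dual x z - dual x y.
    exact: (@scalar_fctB R Y (dual x)).
  by rewrite bxy bE -EFinB lee_fin lerB.
split.
- by move=> x y; rewrite bE.
- split.
  + split=> [y|x]; split=> //.
    * by move=> x; rewrite bE.
    * exact: lower_semicontinuous_inf (lscX y).
    * by move=> y; rewrite bE.
    * exact: lower_semicontinuous_inf (lscY x).
  + by move=> x y; rewrite bE lee_fin.
  + by move=> x y; rewrite subX subY.
- rewrite ME; apply/seteqP; split => -[x y].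
    (* On the graph of one [phi l], [b] is squeezed between [dual x y] and the sum for [l]. *)
    move=> [l _]; rewrite /lagrangian /bipotential_graph /= fE => -[lE].
    rewrite bE; congr EFin; apply/le_anti; rewrite dual_le andbT.
    by rewrite -lE B_le.
  rewrite /bipotential_graph /= bE => -[].
  (* Conversely, an index attaining the infimum has [(x, y)] on its graph. *)
  have [l -> lE] := B_min x y; exists l => //.
  by rewrite /lagrangian /= fE lE.
Qed.
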